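(* Let $\Bbbk$ be a field of characteristic different from $2$ and let $B$ be an associative unital $\Bbbk$-algebra. For $\mathcal{F}\in End_{\Bbbk}(B)$ (a linear endomorphism) and an invertible element $c\in B$, define $$1\cdot e=e,\quad x\cdot e=\mathcal{F}(e)\quad(e\in B),\qquad\sigma(x,x)=c,\quad\sigma(1,1)=\sigma(1,x)=\sigma(x,1)=1_B .$$ Then $(B,\cdot,\sigma)$ is an $H(2)$-crossed system if and only if (1) $\mathcal{F}$ is an algebra morphism; (2) $\mathcal{F}^2(e)=cec^{-1}$ for all $e\in B$; (3) $\mathcal{F}(c)=-c$.
   Context: $H(2)$ is the coquasi-Hopf algebra over $\Bbbk$ with basis $\{1,x\}$, $x$ grouplike, $x^2=1$ (as algebra and coalgebra it is the group algebra $\Bbbk[C_2]$), with reassociator $\omega\in(H(2)^{\otimes 3})^*$ given by $\omega(x,x,x)=-1$ and $\omega=1$ on all other triples of basis elements. $H$-crossed system $(B,\cdot,\sigma)$ (for $H=H(2)$): a bilinear map $\cdot:H\otimes B\to B$ and a linear map $\sigma:H\otimes H\to B$ such that for all $h,g,l\in H$, $r,s\in B$ (Sweedler notation): $h\cdot(rs)=(h_1\cdot r)(h_2\cdot s)$, $h\cdot 1_B=\varepsilon(h)1_B$, $1_H\cdot r=r$, $[h_1\cdot(g_1\cdot r)]\sigma(h_2,g_2)=\sigma(h_1,g_1)[(h_2g_2)\cdot r]$, $\sigma(h,1_H)=\sigma(1_H,h)=\varepsilon(h)1_B$, $[h_1\cdot\sigma(g_1,l_1)]\sigma(h_2,g_2l_2)=\sigma(h_1,g_1)\sigma(h_2g_2,l_1)\omega^{-1}(h_3,g_3,l_2)$.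 Algebra morphisms are unital. *)

(* Defs.v *)
From HB Require Import structures.
From mathcomp Require Import all_boot all_order all_algebra.
From mathcomp Require Import ring.

Set Implicit Arguments.
Unset Strict Implicit.
Unset Printing Implicit Defensive.

Import GRing.Theory.
Local Open Scope ring_scope.

(* The group algebra k[C_2], as an algebra with basis indexed by 'Z_2: the index
   i stands for x^i, so [h : H2 k] is the element h 0 *: 1 + h 1 *: x. The
   alias keeps it apart from {ffun 'Z_2 -> k}, whose ring product is pointwise. *)
Definition H2 (k : fieldType) : Type := {ffun 'Z_2 -> k^o}.

HB.instance Definition _ (k : fieldType) :=
  GRing.Lmodule.copy (H2 k) {ffun 'Z_2 -> k^o}.

Section GroupAlgebra.
Variable k : fieldType.
Implicit Types h g l : H2 k.

Definition H2_coef h : 'Z_2 -> k := fun i => (h : {ffun 'Z_2 -> k^o}) i.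

Definition H2_basis (i : 'Z_2) : H2 k := [ffun j => (j == i)%:R] : {ffun _ -> k^o}.

Definition H2_mul h g : H2 k :=
  \sum_i \sum_j (H2_coef h i * H2_coef g j) *: H2_basis (i + j).

Lemma H2_coefP h g : H2_coef h 0 = H2_coef g 0 -> H2_coef h 1 = H2_coef g 1 ->
  h = g.
Proof.
move=> e0 e1; apply/ffunP => -[[|[|//]] ilt].
  by move: e0; rewrite /H2_coef (_ : 0 = Ordinal ilt)//; apply: val_inj.
by move: e1; rewrite /H2_coef (_ : 1 = Ordinal ilt)//; apply: val_inj.
Qed.

Lemma H2_coefD h g i : H2_coef (h + g) i = H2_coef h i + H2_coef g i.
Proof. by rewrite /H2_coef ffunE. Qed.

Lemma H2_coefZ a h i : H2_coef (a *: h) i = a * H2_coef h i.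
Proof. by rewrite /H2_coef ffunE. Qed.

Lemma H2_coef_basis i j : H2_coef (H2_basis i) j = (j == i)%:R.
Proof. by rewrite /H2_coef ffunE. Qed.

Lemma big_Z2 (V : nmodType) (f : 'Z_2 -> V) : \sum_i f i = f 0 + f 1.
Proof.
rewrite (bigD1 (0 : 'Z_2))//= (bigD1 (1 : 'Z_2))//= big1 ?addr0//.
by case=> -[|[|//]].
Qed.

Lemma H2_coefM0 h g : H2_coef (H2_mul h g) 0 =
  H2_coef h 0 * H2_coef g 0 + H2_coef h 1 * H2_coef g 1.
Proof.
rewrite /H2_mul !big_Z2 !H2_coefD !H2_coefZ !H2_coef_basis /=.
by rewrite !(mulr1, mulr0, addr0, add0r).
Qed.

Lemma H2_coefM1 h g : H2_coef (H2_mul h g) 1 =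
  H2_coef h 0 * H2_coef g 1 + H2_coef h 1 * H2_coef g 0.
Proof.
rewrite /H2_mul !big_Z2 !H2_coefD !H2_coefZ !H2_coef_basis /=.
by rewrite !(mulr1, mulr0, addr0, add0r).
Qed.

Let H2E := (H2_coefM0, H2_coefM1, H2_coefD, H2_coefZ, H2_coef_basis).

Fact H2_mulA : associative H2_mul.
Proof. by move=> h g l; apply: H2_coefP; rewrite !H2E; ring. Qed.

Fact H2_mul1l : left_id (H2_basis 0) H2_mul.
Proof. by move=> h; apply: H2_coefP; rewrite !H2E /=; ring. Qed.

Fact H2_mul1r : right_id (H2_basis 0) H2_mul.
Proof. by move=> h; apply: H2_coefP; rewrite !H2E /=; ring. Qed.

Fact H2_mulDl : left_distributive H2_mul +%R.
Proof. by move=> h g l; apply: H2_coefP; rewrite !H2E; ring. Qed.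

Fact H2_mulDr : right_distributive H2_mul +%R.
Proof. by move=> h g l; apply: H2_coefP; rewrite !H2E; ring. Qed.

Fact H2_1neq0 : H2_basis 0 != 0.
Proof.
apply/eqP => /(congr1 (fun h => H2_coef h 0)).
by rewrite H2E /H2_coef ffunE => /eqP; rewrite oner_eq0.
Qed.

HB.instance Definition _ := GRing.Zmodule_isNzRing.Build (H2 k)
  H2_mulA H2_mul1l H2_mul1r H2_mulDl H2_mulDr H2_1neq0.

Fact H2_scaleAl a h g : a *: (h * g) = (a *: h) * g.
Proof. by apply: H2_coefP; rewrite !H2E; ring. Qed.

HB.instance Definition _ := GRing.LSemiModule_isLSemiAlgebra.Build k (H2 k) H2_scaleAl.

Fact H2_scaleAr a h g : a *: (h * g) = h * (a *: g).
Proof. by apply: H2_coefP; rewrite !H2E; ring. Qed.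

HB.instance Definition _ := GRing.LSemiAlgebra_isSemiAlgebra.Build k (H2 k) H2_scaleAr.

Definition H2_x : H2 k := H2_basis 1.

Lemma H2_xx : H2_x * H2_x = 1.
Proof. by apply: H2_coefP; rewrite !H2E /=; ring. Qed.

End GroupAlgebra.

Section CoquasiHopf.
Variable k : fieldType.
Implicit Types h g l : H2 k.

(* A tensor is represented by a list of pairs (u, v), standing for the sum of
   the u (x) v: here 1 and x are grouplike. *)
Definition H2_comul h : seq (H2 k * H2 k) :=
  [seq (H2_coef h i *: H2_basis k i, H2_basis k i) | i <- enum 'Z_2].

Definition H2_counit h : k := \sum_i H2_coef h i.

(* Sweedler notation: [f (h_1, h_2)] and [f (h_1, h_2, h_3)]. They depend only on
   the tensors represented when f is multilinear, as it is in every use below. *)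
Definition sweedler2 (V : nmodType) (f : H2 k -> H2 k -> V) h : V :=
  \sum_(p <- H2_comul h) f p.1 p.2.

Definition sweedler3 (V : nmodType) (f : H2 k -> H2 k -> H2 k -> V) h : V :=
  sweedler2 (fun h1 h' => sweedler2 (f h1) h') h.

(* The trilinear form with prescribed values on the basis triples. *)
Definition H2_trilinear (w : 'Z_2 -> 'Z_2 -> 'Z_2 -> k) h g l : k :=
  \sum_i \sum_j \sum_m H2_coef h i * H2_coef g j * H2_coef l m * w i j m.

Definition H2_omega : H2 k -> H2 k -> H2 k -> k :=
  H2_trilinear (fun i j m => if [&& i == 1, j == 1 & m == 1] then -1 else 1).

(* The convolution inverse of [H2_omega], which takes values +1 and -1 on triples
   of grouplikes, hence is its own inverse: see [H2_omegaK] and [H2_omegaVK]. *)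
Definition H2_omegaV : H2 k -> H2 k -> H2 k -> k := H2_omega.

Lemma H2_omegaE i j m : H2_omega (H2_basis k i) (H2_basis k j) (H2_basis k m) =
  if [&& i == 1, j == 1 & m == 1] then -1 else 1.
Proof.
rewrite /H2_omega /H2_trilinear !big_Z2 !H2_coef_basis.
by case: i => -[|[|//]] ?; case: j => -[|[|//]] ?; case: m => -[|[|//]] ? /=; ring.
Qed.

Lemma sweedler2E (V : nmodType) (f : H2 k -> H2 k -> V) h :
  sweedler2 f h = f (H2_coef h 0 *: 1) 1 + f (H2_coef h 1 *: H2_x k) (H2_x k).
Proof. by rewrite /sweedler2 /H2_comul big_map big_enum big_Z2. Qed.

Lemma H2_omegaK h g l :
  sweedler2 (fun h1 h2 => sweedler2 (fun g1 g2 => sweedler2 (fun l1 l2 =>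
    (H2_omega h1 g1 l1 * H2_omegaV h2 g2 l2 : k)) l) g) h
  = H2_counit h * H2_counit g * H2_counit l.
Proof.
rewrite !sweedler2E /H2_omegaV /H2_omega /H2_trilinear /H2_counit !big_Z2.
rewrite !(H2_coefZ, H2_coef_basis) /=; ring.
Qed.

Lemma H2_omegaVK h g l :
  sweedler2 (fun h1 h2 => sweedler2 (fun g1 g2 => sweedler2 (fun l1 l2 =>
    (H2_omegaV h1 g1 l1 * H2_omega h2 g2 l2 : k)) l) g) h
  = H2_counit h * H2_counit g * H2_counit l.
Proof. exact: H2_omegaK. Qed.

End CoquasiHopf.

Definition crossed_system (k : fieldType) (B : algType k)
    (act : {bilinear H2 k -> B -> B}) (sigma : {bilinear H2 k -> H2 k -> B}) : Prop :=
  [/\ forall h r s, act h (r * s) = sweedler2 (fun h1 h2 => act h1 r * act h2 s) h,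
      forall h, act h 1 = H2_counit h *: 1 /\ forall r, act 1 r = r,
      forall h g r,
        sweedler2 (fun h1 h2 => sweedler2 (fun g1 g2 =>
          act h1 (act g1 r) * sigma h2 g2) g) h
        = sweedler2 (fun h1 h2 => sweedler2 (fun g1 g2 =>
            sigma h1 g1 * act (h2 * g2) r) g) h,
      forall h, sigma h 1 = H2_counit h *: 1 /\ sigma 1 h = H2_counit h *: 1
    & forall h g l,
        sweedler2 (fun h1 h2 => sweedler2 (fun g1 g2 => sweedler2 (fun l1 l2 =>
          act h1 (sigma g1 l1) * sigma h2 (g2 * l2)) l) g) h
        = sweedler3 (fun h1 h2 h3 => sweedler3 (fun g1 g2 g3 =>
            sweedler2 (fun l1 l2 =>
              H2_omegaV h3 g3 l2 *: (sigma h1 g1 * sigma (h2 * g2) l1)) l) g) h].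

Section Data.
Variables (k : fieldType) (B : algType k).

Definition H2_act (F : {linear B -> B}) (h : H2 k) (e : B) : B :=
  H2_coef h 0 *: e + H2_coef h 1 *: F e.

Fact H2_act_bilinear F : bilinear_for *:%R *:%R (H2_act F).
Proof.
split=> [e a h g | h a e e'] /=; rewrite /H2_act.
  by rewrite !(H2_coefD, H2_coefZ) !scalerDl scalerDr !scalerA addrACA.
by rewrite (linearP F) !scalerDr !scalerA !(mulrC a) addrACA.
Qed.

HB.instance Definition _ F :=
  bilinear_isBilinear.Build k (H2 k) B B *:%R *:%R (H2_act F) (H2_act_bilinear F).

Definition H2_sigma (c : B) (h g : H2 k) : B :=
  \sum_i \sum_j (H2_coef h i * H2_coef g j) *:
    (if (i == 1) && (j == 1) then c else 1).

Fact H2_sigma_bilinear c : bilinear_for *:%R *:%R (H2_sigma c).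
Proof.
split=> [g a h h' | h a g g'] /=; rewrite /H2_sigma scaler_sumr -big_split;
  apply: eq_bigr => i _; rewrite scaler_sumr -big_split; apply: eq_bigr => j _;
  by rewrite !(H2_coefD, H2_coefZ) scalerA /= -scalerDl; congr (_ *: _); ring.
Qed.

HB.instance Definition _ c :=
  bilinear_isBilinear.Build k (H2 k) (H2 k) B *:%R *:%R (H2_sigma c)
    (H2_sigma_bilinear c).

Lemma H2_act1 F e : H2_act F 1 e = e.
Proof. by rewrite /H2_act !H2_coef_basis /= scale1r scale0r addr0. Qed.

Lemma H2_actx F e : H2_act F (H2_x k) e = F e.
Proof. by rewrite /H2_act !H2_coef_basis /= scale1r scale0r add0r. Qed.

Lemma H2_sigma_basis c i j : H2_sigma c (H2_basis k i) (H2_basis k j) =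
  if (i == 1) && (j == 1) then c else 1.
Proof.
rewrite /H2_sigma (bigD1 i)//= [X in _ + X]big1 ?addr0 => [|i' /negPf ni].
  rewrite (bigD1 j)//= big1 ?addr0 => [|j' /negPf nj].
    by rewrite !H2_coef_basis !eqxx mulr1 scale1r.
  by rewrite !H2_coef_basis nj mulr0 scale0r.
by rewrite big1 // => j' _; rewrite H2_coef_basis ni mul0r scale0r.
Qed.

End Data.

(* Main.v *)
Require Import Defs.
From HB Require Import structures.
From mathcomp Require Import all_boot all_order all_algebra.
Import GRing.Theory.
Local Open Scope ring_scope.

(** Both sides of every axiom of a crossed system are multilinear in the
    elements [h], [g], [l] of the group algebra, and on the grouplikes [x^i]
    the Sweedler sums collapse to one term. So the axioms are equivalent to
    their instances on grouplikes ([crossed_system_grouplike]), where they say: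
    each [x^i] acts by a unital algebra endomorphism, [x^0] acts trivially, the
    action is multiplicative up to conjugation by [sigma], and [sigma] is a
    normalized 2-cocycle twisted by [omega].

    For the data built from [F] and [c], every instance involving [1] holds
    automatically once [F] is unital. At [x] one is left with: [F] is an
    algebra morphism (multiplicativity and unitality), [F (F e) * c = c * e]
    (that is, [F (F e) = c * e * c^-1]), and the cocycle condition at
    [(x, x, x)], which reads [F c = - c] because [omega] is [-1] there. *)

(** * Sweedler sums over grouplikes *)

Section GrouplikeSums.
Variable k : fieldType.
Implicit Types (h : H2 k) (i j : 'Z_2).

Lemma H2_sum_basis h : h = \sum_i H2_coef h i *: H2_basis k i.
Proof.
by apply: H2_coefP;
  rewrite big_Z2 !(H2_coefD, H2_coefZ, H2_coef_basis) /= mulr1 mulr0 ?addr0 ?add0r.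
Qed.

Lemma H2_basisM i j : H2_basis k i * H2_basis k j = H2_basis k (i + j).
Proof.
by case: i => -[|[|//]] ?; case: j => -[|[|//]] ?; apply: H2_coefP;
  rewrite !(H2_coefM0, H2_coefM1, H2_coef_basis) /=
    !(mulr0, mulr1, mul0r, addr0, add0r).
Qed.

Lemma sum_coef_basis (V : lmodType k) (f : 'Z_2 -> V) i :
  \sum_j H2_coef (H2_basis k i) j *: f j = f i.
Proof.
rewrite (bigD1 i) //= H2_coef_basis eqxx scale1r big1 ?addr0 // => j /negPf ji.
by rewrite H2_coef_basis ji scale0r.
Qed.

Lemma H2_counit_basis i : H2_counit (H2_basis k i) = 1.
Proof.
rewrite /H2_counit -[RHS](sum_coef_basis k^o (fun=> 1) i).
by apply: eq_bigr => j _; rewrite [RHS]mulr1.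
Qed.

(** Grouplikes have [x^i (x) x^i] as comultiplication, so only diagonal terms
    survive. The coefficient of [x^i] sits on the first leg, whence the
    homogeneity required there. *)
Lemma sweedler2_grouplike (V : lmodType k) (f : H2 k -> H2 k -> V) h :
  (forall a u v, f (a *: u) v = a *: f u v) ->
  sweedler2 f h = \sum_i H2_coef h i *: f (H2_basis k i) (H2_basis k i).
Proof.
move=> fZ; rewrite /sweedler2 /H2_comul big_map big_enum.
by apply: eq_bigr => i _; rewrite fZ.
Qed.

(** Splitting the second leg again, which is already a grouplike, puts on it
    coordinates equal to 0 or 1: this is what homogeneity in the second argument
    serves for. *)
Lemma sweedler3_grouplike (V : lmodType k) (f : H2 k -> H2 k -> H2 k -> V) h :
  (forall a u v w, f (a *: u) v w = a *: f u v w) ->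
  (forall a u v w, f u (a *: v) w = a *: f u v w) ->
  sweedler3 f h =
  \sum_i H2_coef h i *: f (H2_basis k i) (H2_basis k i) (H2_basis k i).
Proof.
move=> fZ1 fZ2; rewrite /sweedler3 sweedler2_grouplike => [|a u v].
  by apply: eq_bigr => i _; rewrite sweedler2_grouplike ?sum_coef_basis.
by rewrite /sweedler2 scaler_sumr; apply: eq_bigr => p _; rewrite fZ1.
Qed.

Lemma sweedler2Z (V : lmodType k) (f g : H2 k -> H2 k -> V) a h :
  (forall u v, f u v = a *: g u v) -> sweedler2 f h = a *: sweedler2 g h.
Proof.
by move=> fg; rewrite /sweedler2 scaler_sumr; apply: eq_bigr => p _; apply: fg.
Qed.

Lemma sweedler3Z (V : lmodType k) (f g : H2 k -> H2 k -> H2 k -> V) a h :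
  (forall u v w, f u v w = a *: g u v w) -> sweedler3 f h = a *: sweedler3 g h.
Proof. by move=> fg; apply: sweedler2Z => u v; apply: sweedler2Z => *. Qed.

End GrouplikeSums.

(** * Crossed systems on grouplikes *)

Section Grouplike.
Variables (k : fieldType) (B : algType k).
Variables (act : {bilinear H2 k -> B -> B}) (sigma : {bilinear H2 k -> H2 k -> B}).
Implicit Types (h g l : H2 k) (i j m : 'Z_2).
Local Notation b := (H2_basis k).

Let actZ a h r : act (a *: h) r = a *: act h r.
Proof. exact: linearZl_LR. Qed.

Let sigmaZl a h g : sigma (a *: h) g = a *: sigma h g.
Proof. exact: linearZl_LR. Qed.

Let actE h r : act h r = \sum_i H2_coef h i *: act (b i) r.
Proof.
rewrite {1}(H2_sum_basis k h) linear_sumlz.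
by apply: eq_bigr => i _; rewrite actZ.
Qed.

Lemma sweedler_act_mul h r s :
  sweedler2 (fun h1 h2 => act h1 r * act h2 s) h =
  \sum_i H2_coef h i *: (act (b i) r * act (b i) s).
Proof. by rewrite sweedler2_grouplike // => *; rewrite actZ scalerAl. Qed.

Lemma sweedler_act_act h g r :
  sweedler2 (fun h1 h2 => sweedler2 (fun g1 g2 =>
    act h1 (act g1 r) * sigma h2 g2) g) h =
  \sum_i H2_coef h i *: \sum_j H2_coef g j *:
    (act (b i) (act (b j) r) * sigma (b i) (b j)).
Proof.
rewrite sweedler2_grouplike => [|a u v].
  apply: eq_bigr => i _; rewrite sweedler2_grouplike // => a u v.
  by rewrite actZ linearZr_LR scalerAl.
by apply: sweedler2Z => *; rewrite actZ scalerAl.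
Qed.

Lemma sweedler_sigma_act h g r :
  sweedler2 (fun h1 h2 => sweedler2 (fun g1 g2 =>
    sigma h1 g1 * act (h2 * g2) r) g) h =
  \sum_i H2_coef h i *: \sum_j H2_coef g j *:
    (sigma (b i) (b j) * act (b (i + j)) r).
Proof.
rewrite sweedler2_grouplike => [|a u v].
  apply: eq_bigr => i _; rewrite sweedler2_grouplike => [|a u v].
    by under eq_bigr do rewrite H2_basisM.
  by rewrite linearZr_LR scalerAl.
by apply: sweedler2Z => *; rewrite sigmaZl scalerAl.
Qed.

Lemma sweedler_cocycle_l h g l :
  sweedler2 (fun h1 h2 => sweedler2 (fun g1 g2 => sweedler2 (fun l1 l2 =>
    act h1 (sigma g1 l1) * sigma h2 (g2 * l2)) l) g) h =
  \sum_i H2_coef h i *: \sum_j H2_coef g j *: \sum_m H2_coef l m *: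
    (act (b i) (sigma (b j) (b m)) * sigma (b i) (b (j + m))).
Proof.
rewrite sweedler2_grouplike => [|a u v].
  apply: eq_bigr => i _; rewrite sweedler2_grouplike => [|a u v].
    congr (_ *: _); apply: eq_bigr => j _; rewrite sweedler2_grouplike => [|a u v].
      by under eq_bigr do rewrite H2_basisM.
    by rewrite !linearZr_LR scalerAl.
  by apply: sweedler2Z => *; rewrite sigmaZl linearZr_LR scalerAl.
by do 2 apply: sweedler2Z => ? ?; rewrite actZ scalerAl.
Qed.

Lemma sweedler_cocycle_r h g l :
  sweedler3 (fun h1 h2 h3 => sweedler3 (fun g1 g2 g3 => sweedler2 (fun l1 l2 =>
    H2_omegaV h3 g3 l2 *: (sigma h1 g1 * sigma (h2 * g2) l1)) l) g) h =
  \sum_i H2_coef h i *: \sum_j H2_coef g j *: \sum_m H2_coef l m *: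
    (H2_omegaV (b i) (b j) (b m) *:
       (sigma (b i) (b j) * sigma (b (i + j)) (b m))).
Proof.
(* Scalars pull out of either sigma factor, past the value of omega. *)
have scaleA2 a w (p q : B) : w *: ((a *: p) * q) = a *: (w *: (p * q)).
  by rewrite -scalerAl !scalerA mulrC.
have scaleA3 a w (p q : B) : w *: (p * (a *: q)) = a *: (w *: (p * q)).
  by rewrite -scalerAr !scalerA mulrC.
rewrite sweedler3_grouplike => [|a u v w|a u v w].
- apply: eq_bigr => i _; rewrite sweedler3_grouplike => [|a u v w|a u v w].
  + congr (_ *: _); apply: eq_bigr => j _.
    rewrite sweedler2_grouplike ?H2_basisM // => a u v.
    by rewrite linearZr_LR scaleA3.
  + by apply: sweedler2Z => *; rewrite linearZr_LR scaleA2.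
  + by apply: sweedler2Z => *; rewrite -scalerAr sigmaZl scaleA3.
- by apply: sweedler3Z => *; apply: sweedler2Z => *; rewrite sigmaZl scaleA2.
- apply: sweedler3Z => *; apply: sweedler2Z => *.
  by rewrite -scalerAl sigmaZl scaleA3.
Qed.

(** The point of the reduction: by the expansions above each axiom equates two
    multilinear forms, which agree as soon as they agree on grouplikes. *)
Lemma crossed_system_grouplike :
  crossed_system act sigma <->
  [/\ forall i r s, act (b i) (r * s) = act (b i) r * act (b i) s,
      forall i, act (b i) 1 = 1 /\ forall r, act 1 r = r,
      forall i j r, act (b i) (act (b j) r) * sigma (b i) (b j) =
                    sigma (b i) (b j) * act (b (i + j)) r,
      forall i, sigma (b i) 1 = 1 /\ sigma 1 (b i) = 1
    & forall i j m, act (b i) (sigma (b j) (b m)) * sigma (b i) (b (j + m)) =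
        H2_omegaV (b i) (b j) (b m) *:
          (sigma (b i) (b j) * sigma (b (i + j)) (b m))].
Proof.
split=> -[mulP unitP actP sigma1P cocycleP]; split.
- by move=> i r s; rewrite mulP sweedler_act_mul sum_coef_basis.
- move=> i; have [act1 one_act] := unitP (b i); split=> //.
  by rewrite act1 H2_counit_basis scale1r.
- move=> i j r; have := actP (b i) (b j) r.
  by rewrite sweedler_act_act sweedler_sigma_act !sum_coef_basis.
- by move=> i; have := sigma1P (b i); rewrite H2_counit_basis scale1r.
- move=> i j m; have := cocycleP (b i) (b j) (b m).
  by rewrite sweedler_cocycle_l sweedler_cocycle_r !sum_coef_basis.
- move=> h r s; rewrite actE sweedler_act_mul.
  by apply: eq_bigr => i _; rewrite mulP.
- move=> h; split; last by have [] := unitP 0.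
  rewrite actE /H2_counit scaler_suml.
  by apply: eq_bigr => i _; have [-> _] := unitP i.
- move=> h g r; rewrite sweedler_act_act sweedler_sigma_act.
  by do 2!(apply: eq_bigr => ? _; congr (_ *: _)).
- move=> h; rewrite {1 3}(H2_sum_basis k h) linear_sumlz linear_sumr /H2_counit.
  rewrite scaler_suml; split; apply: eq_bigr => i _; have [s1 s2] := sigma1P i.
    by rewrite sigmaZl s1.
  by rewrite linearZr_LR s2.
- move=> h g l; rewrite sweedler_cocycle_l sweedler_cocycle_r.
  by do 3!(apply: eq_bigr => ? _; congr (_ *: _)).
Qed.

End Grouplike.

(** * The classification *)

Lemma Z2P (P : 'Z_2 -> Prop) : P 0 -> P 1 -> forall i, P i.
Proof.
move=> P0 P1 -[[|[|//]] lt_i2].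
  by rewrite (_ : Ordinal lt_i2 = 0) //; apply: val_inj.
by rewrite (_ : Ordinal lt_i2 = 1) //; apply: val_inj.
Qed.

Theorem proposition38 (k : fieldType) (k_char : 2%N \notin [pchar k])
    (B : algType k) (F : {linear B -> B}) (c cV : B)
    (ccV : c * cV = 1) (cVc : cV * c = 1) :
  crossed_system (H2_act F) (H2_sigma c) <->
  [/\ GRing.monoid_morphism F,
      forall e : B, F (F e) = c * e * cV
    & F c = - c].
Proof.
have act0 e : H2_act F (H2_basis k 0) e = e by apply: H2_act1.
have act1 e : H2_act F (H2_basis k 1) e = F e by apply: H2_actx.
have sigmaE := @H2_sigma_basis k B c.
have add11 : 1 + 1 = 0 :> 'Z_2 by apply: val_inj.
split=> [/crossed_system_grouplike /= [mulP unitP actP _ cocycleP]|].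
  split.
  - split=> [|r s]; first by have [] := unitP 1; rewrite act1.
    by have := mulP 1 r s; rewrite !act1.
  - move=> e; have := actP 1 1 e; rewrite !act1 add11 act0 sigmaE /= => <-.
    by rewrite -mulrA ccV mulr1.
  - have := cocycleP 1 1 1; rewrite act1 add11 !sigmaE /H2_omegaV H2_omegaE /=.
    by rewrite !mulr1 scaleN1r.
move=> [[F1 FM] FF Fc]; apply/crossed_system_grouplike; split=> /=.
- by apply: Z2P => r s; rewrite ?act0 ?act1.
- by apply: Z2P; rewrite ?act0 ?act1; split=> // r; apply: act0.
- apply: Z2P; apply: Z2P => r;
    rewrite ?addr0 ?add0r ?add11 ?act0 ?act1 ?act0 ?act1 sigmaE /= ?mulr1 ?mul1r //.
  by rewrite FF -mulrA cVc mulr1.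
- by apply: Z2P; rewrite !sigmaE.
- apply: Z2P; apply: Z2P; apply: Z2P;
    rewrite ?addr0 ?add0r ?add11 ?act0 ?act1 !sigmaE /H2_omegaV H2_omegaE /=
      ?F1 ?Fc ?mulr1 ?mul1r ?scale1r ?scaleN1r //.
Qed.
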